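(* Let $f:X\to Y$ be an abstract simplicial map between simplicial complexes $X$ and $Y$. Then the discrete wedge product commutes with pullback along $f$: for all $k,l\ge 0$, all $\alpha\in C^k(Y)$ and all $\beta\in C^l(Y)$, $$f^*(\alpha\wedge\beta)=f^*\alpha\wedge f^*\beta\quad\text{in } C^{k+l}(X).$$ Equivalently, $\langle f^*(\alpha\wedge\beta),[u_0,\ldots,u_{k+l}]\rangle=\langle f^*\alpha\wedge f^*\beta,[u_0,\ldots,u_{k+l}]\rangle$ for all oriented $(k+l)$-simplices $[u_0,\ldots,u_{k+l}]$ of $X$.
   Context: Chains and cochains: $C_k(X)$ is the real vector space of simplicial $k$-chains of $X$, generated by oriented $k$-simplices $[v_0,\ldots,v_k]$, with $[v_{\pi(0)},\ldots,v_{\pi(k)}]=\operatorname{sgn}(\pi)[v_0,\ldots,v_k]$. $C^k(X)$ is the dual space of $k$-cochains, and $\langle\alpha,c\rangle=\alpha(c)$ is evaluation of a cochain on a chain. Cup product: for $\alpha\in C^k(X)$, $\beta\in C^l(X)$ and any ordering $v_0,\ldots,v_{k+l}$ of the vertices of a $(k+l)$-simplex, the notation $\langle\alpha\smile\beta,[v_0,\ldots,v_{k+l}]\rangle$ means $\langle\alpha,[v_0,\ldots,v_k]\rangle\,\langle\beta,[v_k,\ldots,v_{k+l}]\rangle$ (this depends on the ordering of the vertices). Discrete wedge product: $\alpha\wedge\beta\in C^{k+l}(X)$ is defined on an oriented $(k+l)$-simplex $[v_0,\ldots,v_{k+l}]$ by $$\langle\alpha\wedge\beta,[v_0,\ldots,v_{k+l}]\rangle=\frac{1}{(k+l+1)!}\sum_{\tau\in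 S_{k+l+1}}\operatorname{sgn}(\tau)\,\langle\alpha\smile\beta,[v_{\tau(0)},\ldots,v_{\tau(k+l)}]\rangle,$$ where $S_{k+l+1}$ is the group of permutations of $\{0,\ldots,k+l\}$, and is extended linearly to chains. Abstract simplicial map: $f:X\to Y$ is given by a map on vertex sets such that whenever $\{u_0,\ldots,u_k\}$ spans a simplex in $X$, the set $\{f(u_0),\ldots,f(u_k)\}$ spans a simplex in $Y$ (the images need not be distinct). Induced map on chains: $f_\sharp:C_k(X)\to C_k(Y)$ is the linear map with $f_\sharp([u_0,\ldots,u_k])=[f(u_0),\ldots,f(u_k)]$ if $f(u_0),\ldots,f(u_k)$ are distinct, and $f_\sharp([u_0,\ldots,u_k])=0$ otherwise. Pullback: for $\alpha\in C^k(Y)$, $f^*\alpha\in C^k(X)$ is defined by $f^*\alpha(c)=\alpha(f_\sharp(c))$ for all $c\in C_k(X)$. *)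

(* Defs.v *)
From HB Require Import structures.
From mathcomp Require Import all_boot all_order all_algebra all_fingroup finmap.
From mathcomp Require Import generic_quotient ring_quotient.
From mathcomp Require Import boolp reals.
From mathcomp Require Import freeg.

Set Implicit Arguments.
Unset Strict Implicit.
Unset Printing Implicit Defensive.

Import Order.TTheory GRing.Theory Num.Theory.
Local Open Scope fset_scope.
Local Open Scope ring_scope.

(* [V] is the vertex set: every [v : V] is a vertex of the complex.           *)
Record simplicial_complex (V : choiceType) := SimplicialComplex {
  simplices :> {pred {fset V}};
  simplex_neq0 : forall A, A \in simplices -> A != fset0;
  simplex_sub : forall A B, A \in simplices -> B `<=` A -> B != fset0 ->
    B \in simplices;
  simplex_vertex : forall v, [fset v] \in simplices
}.

Record simplicial_map (V W : choiceType)
    (X : simplicial_complex V) (Y : simplicial_complex W) := SimplicialMap {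
  vmap :> V -> W;
  vmap_simplex : forall A, A \in simplices X -> vmap @` A \in simplices Y
}.

Definition is_osimplex (V : choiceType) (X : simplicial_complex V) (k : nat)
    (v : {ffun 'I_k.+1 -> V}) : bool :=
  injectiveb v && ([fset v i | i in 'I_k.+1] \in simplices X).

(* Vertex orderings [v_0, ..., v_k] of the k-simplices of X. They represent    *)
(* the oriented simplices, two orderings being identified up to sign in the    *)
(* space of chains.                                                            *)
Record osimplex (V : choiceType) (X : simplicial_complex V) (k : nat) :=
  OSimplex {
    vertices :> {ffun 'I_k.+1 -> V};
    osimplexP : is_osimplex X vertices
  }.

HB.instance Definition _ (V : choiceType) (X : simplicial_complex V) (k : nat) :=
  [isSub for @vertices V X k].
HB.instance Definition _ (V : choiceType) (X : simplicial_complex V) (k : nat) :=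
  [Choice of osimplex X k by <:].

Section Reindex.
Variables (V : choiceType) (X : simplicial_complex V).

Lemma osimplex_inj k (v : osimplex X k) : injective v.
Proof. by case: v => v /= /andP[/injectiveP]. Qed.

Lemma osimplex_simplex k (v : osimplex X k) :
  [fset v i | i in 'I_k.+1] \in simplices X.
Proof. by case: v => v /= /andP[]. Qed.

Fact reindex_proof k m (v : osimplex X m) (h : 'I_k.+1 -> 'I_m.+1) :
  injective h -> is_osimplex X [ffun i => v (h i)].
Proof.
move=> h_inj; apply/andP; split.
  apply/injectiveP => i j; rewrite !ffunE => /osimplex_inj; exact: h_inj.
apply: simplex_sub (osimplex_simplex v) _ _.
  apply/fsubsetP => x /imfsetP[i _ ->]; rewrite ffunE.
  by apply/imfsetP; exists (h i).
by apply/fset0Pn; exists (v (h ord0)); apply/imfsetP; exists ord0; rewrite ?ffunE.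
Qed.

Definition reindex k m (v : osimplex X m) (h : 'I_k.+1 -> 'I_m.+1)
  (h_inj : injective h) : osimplex X k := OSimplex (reindex_proof v h_inj).

(* [v_(s 0), ..., v_(s k)] *)
Definition permute k (v : osimplex X k) (s : 'S_k.+1) : osimplex X k :=
  reindex v (@perm_inj _ s).

Fact front_inj k l : injective (fun i : 'I_k.+1 => inord i : 'I_(k + l).+1).
Proof.
move=> i j /(congr1 val) /=; rewrite !inordK ?ltnS; first exact: val_inj.
  by rewrite (leq_trans (leq_ord j)) ?leq_addr.
by rewrite (leq_trans (leq_ord i)) ?leq_addr.
Qed.

Fact back_inj k l :
  injective (fun i : 'I_l.+1 => inord (k + i) : 'I_(k + l).+1).
Proof.
move=> i j /(congr1 val) /=; rewrite !inordK ?ltnS ?leq_add2l ?leq_ord //.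
by move/addnI/val_inj.
Qed.

(* [v_0, ..., v_k] and [v_k, ..., v_(k + l)] *)
Definition front k l (v : osimplex X (k + l)) : osimplex X k :=
  reindex v (@front_inj k l).
Definition back k l (v : osimplex X (k + l)) : osimplex X l :=
  reindex v (@back_inj k l).

Lemma permuteM k (v : osimplex X k) (s t : 'S_k.+1) :
  permute (permute v s) t = permute v (t * s)%g.
Proof. by apply/val_inj/ffunP => i; rewrite !ffunE permM. Qed.

End Reindex.

Section Chains.
Variables (R : realType) (V : choiceType) (X : simplicial_complex V) (k : nat).
Local Open Scope quotient_scope.

Local Notation F := {freeg (osimplex X k) / R}.

(* The linear span, in the free vector space on the ordered simplices, of the  *)
(* elements [v_(s 0), ..., v_(s k)] - sgn(s) [v_0, ..., v_k].                  *)
Inductive orientation_rel : F -> Prop :=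
| OrientationGen (v : osimplex X k) (s : 'S_k.+1) :
    orientation_rel (<< permute v s >> - (-1) ^+ s *: << v >>)
| Orientation0 : orientation_rel 0
| OrientationLin (a : R) (x y : F) :
    orientation_rel x -> orientation_rel y -> orientation_rel (a *: x + y).

Definition orientation_mod : {pred F} := fun x => `[< orientation_rel x >].

Lemma orientation_modP (x : F) :
  reflect (orientation_rel x) (x \in orientation_mod).
Proof. exact: asboolP. Qed.

Fact orientation_zmod : zmod_closed orientation_mod.
Proof.
split=> [|x y /orientation_modP hx /orientation_modP hy].
  by apply/orientation_modP; apply: Orientation0.
apply/orientation_modP; rewrite addrC -scaleN1r; exact: OrientationLin.
Qed.
HB.instance Definition _ := GRing.isZmodClosed.Build F orientation_mod
  orientation_zmod.

Definition chain : Type := Quotient.quot (orientation_mod : zmodClosed F).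
HB.instance Definition _ := GRing.Zmodule.on chain.

Definition chain_proj (x : F) : chain :=
  \pi_(Quotient.quot (orientation_mod : zmodClosed F)) x.
Definition chain_repr (c : chain) : F :=
  repr (c : Quotient.quot (orientation_mod : zmodClosed F)).

Lemma chain_projE (x y : F) :
  chain_proj x = chain_proj y <-> orientation_rel (x - y).
Proof.
split=> [/eqP|] h; first by apply/orientation_modP; rewrite Quotient.idealrBE.
by apply/eqP; rewrite /chain_proj -Quotient.idealrBE; apply/orientation_modP.
Qed.

Lemma chain_reprK c : chain_proj (chain_repr c) = c.
Proof. exact: reprK. Qed.

Lemma chain_projD : {morph chain_proj : x y / x + y}.
Proof. by move=> x y; rewrite /chain_proj raddfD. Qed.

Definition chain_scale (a : R) (c : chain) : chain :=
  chain_proj (a *: chain_repr c).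

Lemma chain_scaleE (a : R) (x : F) :
  chain_scale a (chain_proj x) = chain_proj (a *: x).
Proof.
apply/chain_projE; rewrite -scalerBr -[_ *: _]addr0.
by apply: OrientationLin Orientation0; apply/chain_projE; rewrite chain_reprK.
Qed.

Fact chain_scaleA a b c : chain_scale a (chain_scale b c) = chain_scale (a * b) c.
Proof. by rewrite -(chain_reprK c) !chain_scaleE scalerA. Qed.
Fact chain_scale1 : left_id 1 chain_scale.
Proof. by move=> c; rewrite -(chain_reprK c) chain_scaleE scale1r. Qed.
Fact chain_scaleDr : right_distributive chain_scale +%R.
Proof.
move=> a c d; rewrite -(chain_reprK c) -(chain_reprK d) -chain_projD.
by rewrite !chain_scaleE -chain_projD scalerDr.
Qed.
Fact chain_scaleDl c : {morph chain_scale^~ c : a b / a + b}.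
Proof.
by move=> a b; rewrite -(chain_reprK c) !chain_scaleE -chain_projD scalerDl.
Qed.
HB.instance Definition _ := GRing.Zmodule_isLmodule.Build R chain
  chain_scaleA chain_scale1 chain_scaleDr chain_scaleDl.

Lemma chain_proj_linear : linear chain_proj.
Proof. by move=> a x y; rewrite chain_projD -chain_scaleE. Qed.

Definition oriented (v : osimplex X k) : chain := chain_proj << v >>.

Lemma oriented_permute v (s : 'S_k.+1) :
  oriented (permute v s) = (-1) ^+ s *: oriented v.
Proof.
rewrite /oriented [RHS]chain_scaleE; apply/chain_projE; exact: OrientationGen.
Qed.

(* Linear maps out of the chain space are determined by their values on the    *)
(* oriented simplices, which may be prescribed by any alternating function.    *)
Section Lift.
Variables (L : lmodType R) (g : osimplex X k -> L).
Hypothesis g_alt : forall v (s : 'S_k.+1), g (permute v s) = (-1) ^+ s *: g v.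

Lemma fglift_linear : linear (fglift g : F -> L).
Proof.
have gB := lift_is_additive g.
have g0 : fglift g (0 : F) = 0 by rewrite -(subrr (0 : F)) gB subrr.
have gN x : fglift g (- x : F) = - fglift g x by rewrite -sub0r gB g0 sub0r.
have gD x y : fglift g (x + y : F) = fglift g x + fglift g y.
  by rewrite -{1}[y]opprK gB gN opprK.
have gZ a x : fglift g (a *: x : F) = a *: fglift g x.
  have -> : a *: x = \sum_(v <- dom x) << a * coeff v x *g v >> by [].
  rewrite -{3}(freeg_sumE x) !(big_morph _ gD g0) scaler_sumr.
  by apply: eq_bigr => v _; rewrite !liftU scalerA.
by move=> a x y; rewrite gD gZ.
Qed.
HB.instance Definition _ := GRing.isLinear.Build R F L _ (fglift g : F -> L)
  fglift_linear.

Lemma fglift_rel x : orientation_rel x -> fglift g x = 0.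
Proof.
elim=> [v s||a {}x y _ hx _ hy]; last by rewrite linearP /= hx hy scaler0 addr0.
  by rewrite linearB linearZ /= !liftU !scale1r g_alt subrr.
exact: linear0.
Qed.

Definition chain_lift_fun (c : chain) : L := fglift g (chain_repr c).

Lemma chain_lift_proj x : chain_lift_fun (chain_proj x) = fglift g x.
Proof.
apply/eqP; rewrite -subr_eq0 -linearB; apply/eqP/fglift_rel/chain_projE.
exact: chain_reprK.
Qed.

Fact chain_lift_linear : linear chain_lift_fun.
Proof.
move=> a c d; rewrite -(chain_reprK c) -(chain_reprK d) -chain_proj_linear.
by rewrite !chain_lift_proj linearP.
Qed.
HB.instance Definition _ := GRing.isLinear.Build R chain L _ chain_lift_fun
  chain_lift_linear.

Definition chain_lift : {linear chain -> L} := chain_lift_fun.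

Lemma chain_lift_oriented v : chain_lift (oriented v) = g v.
Proof. by rewrite [LHS]chain_lift_proj liftU scale1r. Qed.

End Lift.

Lemma chain_linear_ext (L : lmodType R) (g h : {linear chain -> L}) :
  (forall v, g (oriented v) = h (oriented v)) -> g =1 h.
Proof.
move=> gh c; rewrite -(chain_reprK c) -(freeg_sumE (chain_repr c)).
rewrite (big_morph chain_proj chain_projD (id1 := 0)); last first.
  by have := chain_projD 0 0; rewrite addr0 => /eqP; rewrite addrC -subr_eq subrr => /eqP.
rewrite !linear_sum; apply: eq_bigr => v _ /=.
have -> : chain_proj << coeff v (chain_repr c) *g v >> =
          coeff v (chain_repr c) *: oriented v.
  rewrite [RHS]chain_scaleE; congr chain_proj; apply/eqP/freeg_eqP => w.
  by rewrite coeffZ !coeffU mul1r.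
by rewrite !linearZ /= gh.
Qed.

End Chains.

Definition cochain (R : realType) (V : choiceType) (X : simplicial_complex V)
  (k : nat) := {linear chain R X k -> R^o}.

Lemma cochain_ext (R : realType) (V : choiceType) (X : simplicial_complex V)
    (k : nat) (alpha beta : cochain R X k) :
  (forall v, alpha (oriented R v) = beta (oriented R v)) -> alpha = beta.
Proof.
move=> /chain_linear_ext/funext.
case: alpha beta => [a [[A] [B]]] [b [[C] [D]]] /= eab; case: _ / eab in C D *.
by rewrite (Prop_irrelevance A C) (Prop_irrelevance B D).
Qed.

Section Induced.
Variables (R : realType) (V W : choiceType).
Variables (X : simplicial_complex V) (Y : simplicial_complex W).
Variables (f : simplicial_map X Y) (k : nat).

Fact image_proof (u : osimplex X k) :
  injective (f \o u) -> is_osimplex Y [ffun i => f (u i)].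
Proof.
move=> fu_inj; apply/andP; split.
  by apply/injectiveP => i j; rewrite !ffunE; apply: fu_inj.
have -> : [fset [ffun i => f (u i)] i | i in 'I_k.+1] =
          f @` [fset u i | i in 'I_k.+1].
  apply/fsetP => w; apply/imfsetP/imfsetP => /= [[i _ ->]|[v /imfsetP[i _ ->] ->]].
    by exists (u i); rewrite ?ffunE //; apply/imfsetP; exists i.
  by exists i; rewrite ?ffunE.
exact/vmap_simplex/osimplex_simplex.
Qed.

Definition image_osimplex (u : osimplex X k) (h : injective (f \o u)) :
  osimplex Y k := OSimplex (image_proof h).

(* [f(u_0), ..., f(u_k)] if these vertices are distinct, and 0 otherwise *)
Definition push_osimplex (u : osimplex X k) : chain R Y k :=
  match injectiveP (f \o u) with
  | ReflectT h => oriented R (image_osimplex h)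
  | ReflectF _ => 0
  end.

Lemma push_osimplex_inj (u : osimplex X k) (h : injective (f \o u)) :
  push_osimplex u = oriented R (image_osimplex h).
Proof.
rewrite /push_osimplex; case: injectiveP => // h'; congr oriented.
exact: val_inj.
Qed.

Lemma push_osimplex_ninj (u : osimplex X k) :
  ~ injective (f \o u) -> push_osimplex u = 0.
Proof. by rewrite /push_osimplex; case: injectiveP. Qed.

Fact push_alt (u : osimplex X k) (s : 'S_k.+1) :
  push_osimplex (permute u s) = (-1) ^+ s *: push_osimplex u.
Proof.
have [h|h] := pselect (injective (f \o u)).
  have h' : injective (f \o permute u s).
    by move=> i j /=; rewrite !ffunE => /h/perm_inj.
  rewrite !push_osimplex_inj -oriented_permute; congr oriented.
  by apply/val_inj/ffunP => i; rewrite !ffunE.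
rewrite !push_osimplex_ninj ?scaler0 // => h'; apply: h => i j /= e.
apply: (@perm_inj _ s^-1%g); apply: h'; by rewrite /= !ffunE !permKV.
Qed.

(* The induced map f_sharp on chains. *)
Definition push : {linear chain R X k -> chain R Y k} := chain_lift push_alt.

Lemma push_oriented u : push (oriented R u) = push_osimplex u.
Proof. exact: chain_lift_oriented. Qed.

Definition pullback (alpha : cochain R Y k) : cochain R X k := alpha \o push.

End Induced.

Section Wedge.
Variables (R : realType) (V : choiceType) (X : simplicial_complex V) (k l : nat).
Variables (alpha : cochain R X k) (beta : cochain R X l).

(* This depends on the ordering [v], not only on the oriented simplex.         *)
Definition cup (v : osimplex X (k + l)) : R :=
  alpha (oriented R (front v)) * beta (oriented R (back v)).

Definition wedge_osimplex (v : osimplex X (k + l)) : R^o :=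
  (((k + l).+1)`!%:R)^-1 *
    \sum_(t : 'S_(k + l).+1) (-1) ^+ t * cup (permute v t).

Fact wedge_alt (v : osimplex X (k + l)) (s : 'S_(k + l).+1) :
  wedge_osimplex (permute v s) = (-1) ^+ s *: wedge_osimplex v.
Proof.
rewrite /wedge_osimplex [RHS]mulrCA; congr (_ * _).
rewrite [in RHS](reindex_inj (mulIg s)) mulr_sumr; apply: eq_bigr => t _.
rewrite /= permuteM [RHS]mulrA; congr (_ * cup _).
by rewrite odd_permM signr_addb mulrCA -signr_addb addbb mulr1.
Qed.

Definition wedge : cochain R X (k + l) := chain_lift wedge_alt.

Lemma wedge_oriented v : wedge (oriented R v) = wedge_osimplex v.
Proof. exact: chain_lift_oriented. Qed.

End Wedge.

(* Main.v *)
Require Import Defs.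
From mathcomp Require Import all_boot all_order all_algebra reals.
From mathcomp Require Import all_fingroup boolp.

(** Evaluate both sides on an ordered simplex [u]. If [f] is injective on [u],
    taking images commutes with permuting the vertices and with taking front
    and back faces, so the sums agree term by term. If [f u_i = f u_j] with
    [i != j], the left side is 0; on the right, composing [t] with the
    transposition of [i] and [j] flips the sign of [t] but leaves the list of
    images [f u_(t 0), ..., f u_(t (k + l))] unchanged, so the sum is its own
    opposite. *)

Set Implicit Arguments.
Unset Strict Implicit.
Unset Printing Implicit Defensive.

Import GRing.Theory Num.Theory.
Local Open Scope ring_scope.

Section PullbackWedge.
Variables (R : realType) (V W : choiceType).
Variables (X : simplicial_complex V) (Y : simplicial_complex W).
Variable f : simplicial_map X Y.

(** Here [u] and [v] may span different simplices: swapping two vertices with the same image can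
    change which face is the front or the back one. *)
Lemma eq_push_osimplex k (u v : osimplex X k) :
  f \o u =1 f \o v -> push_osimplex R f u = push_osimplex R f v.
Proof.
move=> fuv; have [fu_inj|fu_ninj] := pselect (injective (f \o u)).
  have fv_inj : injective (f \o v) by move=> i j; rewrite -!fuv => /fu_inj.
  rewrite !push_osimplex_inj; congr oriented.
  by apply/val_inj/ffunP => i; rewrite !ffunE; apply: fuv.
rewrite !push_osimplex_ninj // => fv_inj.
by apply: fu_ninj => i j; rewrite !fuv => /fv_inj.
Qed.

(** An ordering [w] of a simplex has distinct vertices, so the degenerate case is excluded. Leaving
    [w] arbitrary lets this apply directly to the faces of an image simplex. *)
Lemma push_osimplex_image k (u : osimplex X k) (w : osimplex Y k) :
  (forall i, w i = f (u i)) -> push_osimplex R f u = oriented R w.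
Proof.
move=> wE.
have fu_inj : injective (f \o u).
  by move=> i j /=; rewrite -!wE => /osimplex_inj.
rewrite (push_osimplex_inj R fu_inj); congr oriented.
by apply/val_inj/ffunP => i; rewrite ffunE wE.
Qed.

Lemma pullback_oriented k (alpha : cochain R Y k) (u : osimplex X k) :
  pullback f alpha (oriented R u) = alpha (push_osimplex R f u).
Proof. by rewrite /pullback /= push_oriented. Qed.

Variables (k l : nat) (alpha : cochain R Y k) (beta : cochain R Y l).

Lemma cup_pullbackE (u : osimplex X (k + l)) :
  cup (pullback f alpha) (pullback f beta) u =
  alpha (push_osimplex R f (front u)) * beta (push_osimplex R f (back u)).
Proof. by rewrite /cup !pullback_oriented. Qed.

Lemma eq_cup_pullback (u v : osimplex X (k + l)) :
  f \o u =1 f \o v ->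
  cup (pullback f alpha) (pullback f beta) u =
  cup (pullback f alpha) (pullback f beta) v.
Proof.
move=> fuv; rewrite !cup_pullbackE; congr (alpha _ * beta _);
  by apply: eq_push_osimplex => i /=; rewrite !ffunE; apply: fuv.
Qed.

Lemma cup_pullback_image (u : osimplex X (k + l)) (w : osimplex Y (k + l)) :
  (forall i, w i = f (u i)) ->
  cup (pullback f alpha) (pullback f beta) u = cup alpha beta w.
Proof.
move=> wE; rewrite cup_pullbackE /cup; congr (alpha _ * beta _);
  by apply: push_osimplex_image => i; rewrite !ffunE.
Qed.

Lemma wedge_osimplex_pullback_image (u : osimplex X (k + l))
    (w : osimplex Y (k + l)) :
  (forall i, w i = f (u i)) ->
  wedge_osimplex (pullback f alpha) (pullback f beta) u =
  wedge_osimplex alpha beta w.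
Proof.
move=> wE; congr (_ * _); apply: eq_bigr => t _; congr (_ * _).
by apply: cup_pullback_image => i; rewrite !ffunE.
Qed.

(** Single terms need not vanish: of two vertices with equal image, one may lie only in the front
    face and the other only in the back face. Hence the cancellation in pairs. *)
Lemma wedge_osimplex_pullback_ninj (u : osimplex X (k + l)) :
  ~ injective (f \o u) ->
  wedge_osimplex (pullback f alpha) (pullback f beta) u = 0.
Proof.
move/injectiveP/injectivePn => [i [j ij fuij]].
rewrite /wedge_osimplex; set S := (X in _ * X).
suff SN : S = - S.
  have /eqP : S *+ 2 = 0 by rewrite mulr2n {2}SN subrr.
  by rewrite mulrn_eq0 /= => /eqP ->; rewrite mulr0.
(* In [t * tperm i j] the factor [t] acts first, so the transposition swaps the vertices [u i] and
   [u j], not the positions [i] and [j]. *)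
rewrite /S [LHS](reindex_inj (mulIg (tperm i j))) -sumrN.
apply: eq_bigr => t _ /=.
rewrite odd_permM odd_tperm ij addbT signrN mulNr; congr (- (_ * _)).
apply: eq_cup_pullback => m /=; rewrite !ffunE permM.
by case: tpermP => [->|->|].
Qed.

End PullbackWedge.

Theorem proposition3p9 (R : realType) (V W : choiceType)
    (X : simplicial_complex V) (Y : simplicial_complex W)
    (f : simplicial_map X Y) (k l : nat)
    (alpha : cochain R Y k) (beta : cochain R Y l) :
  pullback f (wedge alpha beta) = wedge (pullback f alpha) (pullback f beta).
Proof.
apply: cochain_ext => u; rewrite wedge_oriented pullback_oriented.
have [fu_inj|fu_ninj] := pselect (injective (f \o u)).
  rewrite (push_osimplex_inj R fu_inj) wedge_oriented.
  by rewrite -(@wedge_osimplex_pullback_image _ _ _ _ _ f _ _ _ _ u) // => i; rewrite ffunE.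
by rewrite push_osimplex_ninj // linear0 wedge_osimplex_pullback_ninj.
Qed.
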